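(* Let $E$ be a Banach space and let $T\colon S\to\mathscr{L}(E)$ be a bounded representation of the commutative semigroup $S$. Then the following conditions are equivalent. (a) $T$ is uniformly mean ergodic. (b) There exists an ergodic net for $T$ that converges in operator norm. (c) Every ergodic net for $T$ converges in operator norm. (d) The constant semigroup character $\mathbf{1}_S$ is a pole of $T$. (e) $\mathrm{rg}(\mathbf{1}_S-T)$ is closed in $E$ and there are $s_1,\dots,s_n\in S$ such that $\mathrm{rg}(\mathbf{1}_S-T)=\sum_{k=1}^n\mathrm{rg}(\mathrm{Id}_E-T_{s_k})$. If the equivalent conditions (a)--(e) are satisfied, then the following assertions hold. (i) Every ergodic net for $T$ converges in operator norm to the mean ergodic projection of $T$. (ii) The projection $P\in\mathscr{L}(E)$ that witnesses that $\mathbf{1}_S$ is a pole of $T$ is uniquely determined and coincides with the mean ergodic projection of $T$. (iii) $E$ can be decomposed as $E=\operatorname{fix}(T)\oplus\mathrm{rg}(\mathbf{1}_S-T)$.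
   Context: $(S,+)$ is a commutative semigroup with neutral element $0$; $S$ carries no topology and is not assumed cancellative. All vector spaces are complex, and $\mathscr{L}(E)$ is the Banach algebra of bounded linear operators on $E$. A representation of $S$ in a unital Banach algebra $A$ is a map $T\colon S\to A$, $s\mapsto T_s$, with $T_{s+t}=T_sT_t$ for all $s,t\in S$ and $T_0=\mathbf{1}$ (the unit of $A$); it is bounded if $\sup_{s\in S}\|T_s\|<\infty$. A unitary semigroup character is a map $\chi\colon S\to\{z\in\mathbb{C}:|z|=1\}$ with $\chi(s+t)=\chi(s)\chi(t)$ and $\chi(0)=1$; the set of all these is $S^{*,\mathrm{uni}}$, and $\mathbf{1}_S\in S^{*,\mathrm{uni}}$ is the constant function $1$. The unitary spectrum $\sigma_{\mathrm{uni}}(T)$ of a bounded representation $T\colon S\to A$ is the set of all $\chi\in S^{*,\mathrm{uni}}$ such that the left ideal of $A$ generated by $\{\chi(s)\mathbf{1}-T_s: s\in S\}$ is not equal to $A$ (so it is empty if $A=\{0\}$). For $T\colon S\to\mathscr{L}(E)$ and $\chi\in S^{*,\mathrm{uni}}$ put $\ker(\chi-T)=\{x\in E: T_sx=\chi(s)x\text{ for all }s\in S\}$, $\operatorname{fix}(T)=\ker(\mathbf{1}_S-T)$, and $\mathrm{rg}(\chi-T)=\sum_{s\in S}\mathrm{rg}(\chi(s)\mathrm{Id}_E-T_s)$ (the linear subspace of all finite sums of elements of the spaces $\mathrm{rg}(\chi(s)\mathrm{Id}_E-T_s)$, $s\in S$). For a closed subspace $F$ invariant under all $T_s$, $T|_F\colon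 S\to\mathscr{L}(F)$ is the restricted representation $s\mapsto T_s|_F$. A character $\chi\in S^{*,\mathrm{uni}}$ is a pole of $T$ if there is a projection $P\in\mathscr{L}(E)$ onto $\ker(\chi-T)$ with $PT_s=T_sP$ for all $s\in S$ and $\chi\notin\sigma_{\mathrm{uni}}(T|_{\ker P})$; such a $P$ is said to witness that $\chi$ is a pole. $T$ is uniformly mean ergodic if the operator norm closed convex hull $\overline{\mathrm{co}}\,T(S)\subseteq\mathscr{L}(E)$ has a zero element $P$, i.e. $P\in\overline{\mathrm{co}}\,T(S)$ and $RP=PR=P$ for all $R\in\overline{\mathrm{co}}\,T(S)$; this (unique) $P$ is called the mean ergodic projection of $T$. An ergodic net for $T$ is a net $(C_j)_{j\in J}$ in $\overline{\mathrm{co}}\,T(S)$ such that $\lim_j(\mathrm{Id}_E-T_s)C_j=0$ in operator norm for every $s\in S$. *)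

(* Defs.v *)
From HB Require Import structures.
From mathcomp Require Import all_boot all_order all_algebra.
From mathcomp Require Import complex.
From mathcomp Require Import all_classical all_reals all_analysis.

Set Implicit Arguments.
Unset Strict Implicit.
Unset Printing Implicit Defensive.

Import Order.TTheory GRing.Theory Num.Theory.
Import numFieldNormedType.Exports.

Local Open Scope classical_set_scope.
Local Open Scope complex_scope.
Local Open Scope ring_scope.

Section BoundedOperators.
Context {R : realType}.
Local Notation C := R[i].

Section Def.
Variable E : normedModType C.

Definition bounded_linear : {pred E -> E} :=
  mem [set f | linear f /\ exists M : C, forall x, `|f x| <= M * `|x|].

Record bounded_op :=
  BoundedOp { op_fun :> E -> E ; op_funP : op_fun \in bounded_linear }.

HB.instance Definition _ := [isSub for op_fun].
HB.instance Definition _ := [Choice of bounded_op by <:].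

Lemma bounded_linear_submod : submod_closed bounded_linear.
Proof.
split.
  rewrite inE; split => [a x y|]; first by rewrite /= scaler0 addr0.
  by exists 0 => x; rewrite normr0 mul0r.
move=> a f g; rewrite !inE => -[lf [M fM]] [lg [N gN]]; split.
  move=> k x y; rewrite /= !fctE lf lg !scalerDr !scalerA (mulrC a k).
  by rewrite addrACA.
exists (`|a| * M + N) => x; rewrite mulrDl -mulrA.
rewrite (le_trans (ler_normD _ _))// lerD// normrZ ler_wpM2l//.
Qed.

HB.instance Definition _ :=
  GRing.isSubmodClosed.Build C (E -> E) bounded_linear bounded_linear_submod.
HB.instance Definition _ := [SubChoice_isSubLmodule of bounded_op by <:].

Lemma opP (f g : bounded_op) : (forall x, f x = g x) <-> f = g.
Proof. by split => [fg|->//]; apply/val_inj/funext. Qed.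

Lemma op_linear (f : bounded_op) : linear f.
Proof. by case: f => f /=; rewrite inE => -[]. Qed.

HB.instance Definition _ (f : bounded_op) :=
  GRing.isLinear.Build C E E _ (op_fun f) (op_linear f).

Lemma op_bounded (f : bounded_op) :
  exists M : R, 0 <= M /\ forall x, `|f x| <= M%:C * `|x|.
Proof.
case: (f) => g /=; rewrite inE => -[_ [M gM]].
exists (complex.Re `|M|); rewrite RRe_real; last by rewrite ger0_real.
split; first by have := normr_ge0 M; rewrite lecE => /andP[_].
move=> x; apply: (le_trans (gM x)).
have M0 : 0 <= M * `|x| by exact: le_trans (gM x).
by rewrite -[leLHS]ger0_norm// normrM normr_id.
Qed.

Lemma op1_subproof : (idfun : E -> E) \in bounded_linear.
Proof. by rewrite inE; split=> //; exists 1 => x; rewrite mul1r. Qed.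

Lemma opM_subproof (f g : bounded_op) : (f \o g : E -> E) \in bounded_linear.
Proof.
rewrite inE; split=> [a x y /=|]; first by rewrite !linearP.
have [M [M0 fM]] := op_bounded f; have [N [N0 gN]] := op_bounded g.
exists (M%:C * N%:C) => x /=; apply: (le_trans (fM _)); rewrite -mulrA.
by rewrite ler_wpM2l// ler0c.
Qed.

Definition op1 : bounded_op := BoundedOp op1_subproof.
Definition opM (f g : bounded_op) : bounded_op := BoundedOp (opM_subproof f g).

Lemma addopE (f g : bounded_op) x : (f + g) x = f x + g x. Proof. by []. Qed.
Lemma oppopE (f : bounded_op) x : (- f) x = - f x. Proof. by []. Qed.
Lemma scaleopE (a : C) (f : bounded_op) x : (a *: f) x = a *: f x.
Proof. by []. Qed.

Fact opMA : associative opM. Proof. by move=> f g h; apply/opP. Qed.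
Fact op1M : left_id op1 opM. Proof. by move=> f; apply/opP. Qed.
Fact opM1 : right_id op1 opM. Proof. by move=> f; apply/opP. Qed.
Fact opMDl : left_distributive opM +%R.
Proof. by move=> f g h; apply/opP. Qed.
Fact opMDr : right_distributive opM +%R.
Proof. by move=> f g h; apply/opP => x; exact: (linearD f). Qed.

(* Only a pzRing: 1 = 0 when E is the zero space. *)
HB.instance Definition _ := GRing.Zmodule_isPzRing.Build bounded_op
  opMA op1M opM1 opMDl opMDr.

Lemma mulopE (f g : bounded_op) x : (f * g) x = f (g x). Proof. by []. Qed.
Lemma oneopE x : (1 : bounded_op) x = x. Proof. by []. Qed.

(* MathComp-Analysis norms take their values in the scalar field, here R[i];
   the supremum itself is taken in R. *)
Definition opnorm (f : bounded_op) : C :=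
  (sup [set complex.Re `|f x| | x in [set x | `|x| <= 1]])%:C.

Lemma opnorm_has_sup (f : bounded_op) :
  has_sup [set complex.Re `|f x| | x in [set x | `|x| <= 1]].
Proof.
split; first by exists (complex.Re `|f 0|), 0 => //=; rewrite normr0.
have [M [M0 fM]] := op_bounded f; exists M => _ [x /= x1 <-].
rewrite -lecR RRe_real ?ger0_real//; apply: (le_trans (fM x)).
by rewrite -[leRHS]mulr1 ler_wpM2l// ler0c.
Qed.

Lemma opnorm_ge0 (f : bounded_op) : 0 <= opnorm f.
Proof.
rewrite ler0c; apply: (@le_trans _ _ (complex.Re `|f 0|)).
  by rewrite linear0 normr0.
by apply: sup_upper_bound (opnorm_has_sup f) _ _; exists 0; rewrite //= normr0.
Qed.

Lemma le_opnorm (f : bounded_op) x : `|f x| <= opnorm f * `|x|.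
Proof.
have [->|x0] := eqVneq x 0; first by rewrite linear0 !normr0 mulr0.
have nx : 0 < `|x| by rewrite normr_gt0.
rewrite -ler_pdivrMr// mulrC.
have -> : `|x|^-1 * `|f x| = `|f (`|x|^-1 *: x)|.
  by rewrite linearZ normrZ ger0_norm ?invr_ge0.
rewrite -[leLHS]RRe_real ?ger0_real// lecR.
apply: sup_upper_bound (opnorm_has_sup f) _ _; exists (`|x|^-1 *: x) => //=.
by rewrite normrZ ger0_norm ?invr_ge0// mulVf ?lt0r_neq0.
Qed.

Lemma opnorm_le (f : bounded_op) (M : C) :
  0 <= M -> (forall x, `|f x| <= M * `|x|) -> opnorm f <= M.
Proof.
move=> M0 fM; rewrite -[leRHS]RRe_real ?ger0_real// lecR.
apply: ge_sup; first by case: (opnorm_has_sup f).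
move=> _ [x /= x1 <-]; rewrite -lecR !RRe_real ?ger0_real//.
by apply: (le_trans (fM x)); rewrite -[leRHS]mulr1 ler_wpM2l.
Qed.

Fact opnormD (f g : bounded_op) : opnorm (f + g) <= opnorm f + opnorm g.
Proof.
apply: opnorm_le => [|x]; first by rewrite addr_ge0 ?opnorm_ge0.
by rewrite mulrDl (le_trans (ler_normD _ _))// lerD ?le_opnorm.
Qed.

Fact opnormZ (a : C) (f : bounded_op) : opnorm (a *: f) = `|a| * opnorm f.
Proof.
apply/le_anti/andP; split.
  apply: opnorm_le => [|x]; first by rewrite mulr_ge0 ?opnorm_ge0.
  by rewrite scaleopE normrZ -mulrA ler_wpM2l ?le_opnorm.
have [->|a0] := eqVneq a 0; first by rewrite normr0 mul0r opnorm_ge0.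
rewrite mulrC -ler_pdivlMr ?normr_gt0//; apply: opnorm_le => [|x].
  by rewrite divr_ge0 ?opnorm_ge0.
rewrite mulrAC ler_pdivlMr ?normr_gt0// mulrC -normrZ -scaleopE.
exact: le_opnorm.
Qed.

Fact opnorm0_eq0 (f : bounded_op) : opnorm f = 0 -> f = 0.
Proof.
move=> f0; apply/opP => x; apply/eqP; rewrite -normr_le0.
by rewrite (le_trans (le_opnorm f x))// f0 mul0r.
Qed.

HB.instance Definition _ := Lmodule_isNormed.Build C bounded_op
  opnormD opnormZ opnorm0_eq0.

Lemma opnormE (f : bounded_op) : `|f| = opnorm f. Proof. by []. Qed.

Lemma opnormM (f g : bounded_op) : `|f * g| <= `|f| * `|g|.
Proof.
rewrite !opnormE; apply: opnorm_le => [|x].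
  by rewrite mulr_ge0 ?opnorm_ge0.
rewrite mulopE (le_trans (le_opnorm f _))// -mulrA ler_wpM2l ?opnorm_ge0//.
exact: le_opnorm.
Qed.

Lemma op_continuous (f : bounded_op) : continuous f.
Proof.
apply/bounded_linear_continuous/bounded_funP => r.
exists (opnorm f * r) => x xr; apply: (le_trans (le_opnorm f x)).
by rewrite ler_wpM2l ?opnorm_ge0.
Qed.

End Def.
End BoundedOperators.

Notation "''L(' E )" := (bounded_op E) (format "''L(' E )") : type_scope.

Section ClosedSubspaces.
Context {R : realType} {E : normedModType R[i]}.
Local Notation C := R[i].

Record closed_subspace := ClosedSubspace {
  subspace_set : set E ;
  subspace_submod : submod_closed (mem subspace_set : {pred E}) ;
  subspace_closed : closed subspace_set
}.

Section Subspace.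
Variable F : closed_subspace.

Definition in_subspace : {pred E} := mem (subspace_set F).

Record subspace_type :=
  SubspaceElt { subspace_val :> E ; subspace_valP : subspace_val \in in_subspace }.

HB.instance Definition _ := [isSub for subspace_val].
HB.instance Definition _ := [Choice of subspace_type by <:].
HB.instance Definition _ :=
  GRing.isSubmodClosed.Build C E in_subspace (subspace_submod F).
HB.instance Definition _ := [SubChoice_isSubLmodule of subspace_type by <:].

Fact subspace_normD (x y : subspace_type) :
  `|subspace_val (x + y)| <= `|subspace_val x| + `|subspace_val y|.
Proof. exact: ler_normD. Qed.

Fact subspace_normZ (a : C) (x : subspace_type) :
  `|subspace_val (a *: x)| = `|a| * `|subspace_val x|.
Proof. exact: normrZ. Qed.

Fact subspace_norm0_eq0 (x : subspace_type) : `|subspace_val x| = 0 -> x = 0.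
Proof. by move=> /normr0_eq0 x0; apply: val_inj. Qed.

HB.instance Definition _ := Lmodule_isNormed.Build C subspace_type
  subspace_normD subspace_normZ subspace_norm0_eq0.

Definition op_invariant (A : 'L(E)) : Prop := forall x, subspace_set F x -> subspace_set F (A x).

Section Restriction.
Variables (A : 'L(E)) (FA : op_invariant A).

Fact restr_elt_subproof (x : subspace_type) : A x \in in_subspace.
Proof. by rewrite inE; apply: FA; have := subspace_valP x; rewrite inE. Qed.

Definition restr_fun (x : subspace_type) : subspace_type :=
  SubspaceElt (restr_elt_subproof x).

Fact restr_subproof : restr_fun \in @bounded_linear _ subspace_type.
Proof.
rewrite inE; split=> [a x y|]; first by apply: val_inj; exact: op_linear.
by exists (opnorm A) => x; exact: le_opnorm.
Qed.

Definition restr : 'L(subspace_type) := BoundedOp restr_subproof.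

End Restriction.
End Subspace.

Fact op_ker_submod (A : 'L(E)) :
  submod_closed (mem [set x | A x = 0] : {pred E}).
Proof.
split; first by rewrite inE /= linear0.
by move=> a x y /set_mem/= Ax /set_mem/= Ay; rewrite inE /= (op_linear A) Ax Ay scaler0 addr0.
Qed.

Fact op_ker_closed (A : 'L(E)) : closed [set x | A x = 0].
Proof.
apply: (@closed_comp _ _ A [set 0]) => [x _|]; first exact: op_continuous.
exact/accessible_closed_set1/hausdorff_accessible/norm_hausdorff.
Qed.

Definition op_ker (A : 'L(E)) : closed_subspace :=
  ClosedSubspace (op_ker_submod A) (@op_ker_closed A).

Lemma op_ker_invariant (P A : 'L(E)) : P * A = A * P -> op_invariant (op_ker P) A.
Proof. by move=> PA x /= Px; rewrite -mulopE PA mulopE Px linear0. Qed.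

End ClosedSubspaces.

(* [nmodType] is the structure of commutative monoids in additive notation; no
   cancellation is assumed. *)
Section Representations.
Context {R : realType} {S : nmodType}.
Local Notation C := R[i].

Definition representation (A : pzRingType) (T : S -> A) : Prop :=
  T 0 = 1 /\ forall s t, T (s + t) = T s * T t.

Definition unitary_character (chi : S -> C) : Prop :=
  [/\ forall s, `|chi s| = 1, chi 0 = 1 &
      forall s t, chi (s + t) = chi s * chi t].

Definition left_ideal (A : pzRingType) (I : set A) : Prop :=
  [/\ I 0, forall x y, I x -> I y -> I (x + y) & forall a x, I x -> I (a * x)].

(* E is only assumed normed so that the definition applies to the type of a
   closed subspace; when E = {0} the ideal {0} is everything and the spectrum is
   empty. *)
Definition unitary_spectrum (E : normedModType C) (T : S -> 'L(E)) :
    set (S -> C) :=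
  [set chi | unitary_character chi /\
    smallest (@left_ideal 'L(E)) [set chi s *: (1 : 'L(E)) - T s | s in [set: S]]
      <> [set: 'L(E)]].

Section OnE.
Variables (E : normedModType C) (T : S -> 'L(E)).

Definition char_ker (chi : S -> C) : set E :=
  [set x | forall s, T s x = chi s *: x].

Definition fix_space : set E := char_ker (fun=> 1).

Definition subspace_sum (I : Type) (F : I -> set E) : set E :=
  [set y | exists (n : nat) (i : 'I_n -> I) (v : 'I_n -> E),
    (forall k, F (i k) (v k)) /\ y = \sum_(k < n) v k].

Definition rg (chi : S -> C) : set E :=
  subspace_sum (fun s : S => range (chi s *: (1 : 'L(E)) - T s)).

Definition restr_rep (F : closed_subspace) (FT : forall s, op_invariant F (T s)) :
  S -> 'L(subspace_type F) := fun s => restr (FT s).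

Definition projection_onto (P : 'L(E)) (F : set E) : Prop :=
  P * P = P /\ range P = F.

(* The proof PT that P commutes with T is what makes ker P invariant, hence the
   restriction of T to ker P definable. *)
Definition witnesses_pole (chi : S -> C) (P : 'L(E)) : Prop :=
  projection_onto P (char_ker chi) /\
  exists PT : forall s, P * T s = T s * P,
    ~ unitary_spectrum (restr_rep (fun s => op_ker_invariant (PT s))) chi.

Definition pole (chi : S -> C) : Prop :=
  unitary_character chi /\ exists P, witnesses_pole chi P.

Definition convex_hull (A : set 'L(E)) : set 'L(E) :=
  smallest (@convex_set C 'L(E)) A.

Definition clco : set 'L(E) := closure (convex_hull (range T)).

Definition zero_element (K : set 'L(E)) (P : 'L(E)) : Prop :=
  K P /\ forall Q, K Q -> Q * P = P /\ P * Q = P.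

Definition mean_ergodic_projection (P : 'L(E)) : Prop := zero_element clco P.

Definition uniformly_mean_ergodic : Prop :=
  exists P, mean_ergodic_projection P.

End OnE.
End Representations.

Record directed_set := DirectedSet {
  dir_type :> Type ;
  dir_le : dir_type -> dir_type -> Prop ;
  dir_refl : forall i, dir_le i i ;
  dir_trans : forall i j k, dir_le i j -> dir_le j k -> dir_le i k ;
  dir_inh : inhabited dir_type ;
  dir_ub : forall i j, exists k, dir_le i k /\ dir_le j k
}.

Definition tails (J : directed_set) : set_system J :=
  filter_from [set: J] (fun i => [set j | dir_le i j]).
Arguments tails : clear implicits.

Lemma tails_proper (J : directed_set) : ProperFilter (tails J).
Proof.
apply: filter_from_proper; last by move=> i _; exists i; exact: dir_refl.
have [i0] := dir_inh J.
apply: filter_from_filter; first by exists i0.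
move=> i j _ _; have [k [ik jk]] := dir_ub i j.
by exists k => // l /= kl; split; [exact: dir_trans ik kl|exact: dir_trans jk kl].
Qed.
#[export] Hint Extern 0 (ProperFilter (tails _)) =>
  apply: tails_proper : typeclass_instances.

Section ErgodicNets.
Context {R : realType} {S : nmodType} {E : normedModType R[i]}.
Variable T : S -> 'L(E).

Definition ergodic_net (J : directed_set) (A : J -> 'L(E)) : Prop :=
  (forall j, clco T (A j)) /\
  forall s, (1 - T s) * A j @[j --> tails J] --> (0 : 'L(E)).

Definition net_converges (J : directed_set) (A : J -> 'L(E)) : Prop :=
  exists B : 'L(E), A j @[j --> tails J] --> B.

End ErgodicNets.

Definition direct_sum (K : pzRingType) (E : lmodType K) (F G : set E) : Prop :=
  F `&` G = [set 0] /\ forall x, exists y z, [/\ F y, G z & x = y + z].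

(* Main.v *)
(* The convex hull of T(S), directed by divisibility, is itself an ergodic net,
   and any ergodic net A_j satisfies A_j (1 - Q) -> 0 for Q in the closed convex
   hull, hence converges to the mean ergodic projection P once P exists.
   On F = ker P, for P mean ergodic, some A in the convex hull has norm less
   than 1/2, so 1 - A, which is a convex combination of operators 1 - T_s, is
   invertible by the Neumann series and the spectral ideal is everything.
   Conversely, if P witnesses a pole, the operators B on ker P with B A_j -> 0
   form a left ideal containing every 1 - T_s, so A_j -> 0 on ker P, and the
   invertibility of 1 - A_j there shows that ker P = rg(1 - T) is a finite sum
   of ranges. Finally, if rg(1 - T) is closed and finitely generated, the
   uniform boundedness principle bounds A on it by a multiple of
   max_k ||A (1 - T_(s_k))||, so again A_j -> 0 there, and inverting 1 - A_j
   yields the projection along rg(1 - T) onto the fixed space. *)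

Require Import Defs.
From mathcomp Require Import all_boot all_order all_algebra.
From mathcomp Require Import complex.
From mathcomp Require Import ring lra.
From mathcomp Require Import all_classical all_reals all_analysis.

Set Implicit Arguments.
Unset Strict Implicit.
Unset Printing Implicit Defensive.

Import Order.TTheory GRing.Theory Num.Theory.
Import numFieldNormedType.Exports.

Local Open Scope classical_set_scope.
Local Open Scope complex_scope.
Local Open Scope ring_scope.

(** * Complex-valued norms and geometric convergence *)

Section Preliminaries.
Context {R : realType}.
Local Notation C := R[i].

Lemma norm_complexE (E : normedModType C) (x : E) : `|x| = (complex.Re `|x|)%:C.
Proof. by rewrite RRe_real ?normr_real. Qed.

Lemma gt0_complexP (e : C) : 0 < e -> exists2 r : R, 0 < r & e = r%:C.
Proof.
move=> e0; exists (complex.Re e); last by rewrite RRe_real ?gtr0_real.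
by move: e0; rewrite ltcE => /andP[].
Qed.

Lemma ge0_complexP (e : C) : 0 <= e -> exists2 r : R, 0 <= r & e = r%:C.
Proof.
move=> e0; exists (complex.Re e); last by rewrite RRe_real ?ger0_real.
by move: e0; rewrite lecE => /andP[].
Qed.

(** Summing the increments bounds [u (n + m) - u n] uniformly in [m], so [u] is Cauchy and the limit
    inherits the bound. The explicit tail serves the gliding hump below. *)
Lemma geometric_increments_cvg (E : completeNormedModType C) (u : nat -> E)
    (c q : R) :
    0 <= q -> q < 1 -> (forall n, `|u n.+1 - u n| <= (c * q ^+ n)%:C) ->
  exists l, u n @[n --> \oo] --> l /\
    forall n, `|l - u n| <= (c * q ^+ n / (1 - q))%:C.
Proof.
move=> q0 q1 uq.
have q1' : 0 < 1 - q by rewrite subr_gt0.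
have c0 : 0 <= c.
  by have := le_trans (normr_ge0 _) (uq 0%N); rewrite expr0 mulr1 ler0c.
have um n m : `|u (n + m)%N - u n| <= (c * q ^+ n / (1 - q))%:C.
  have um' : `|u (n + m)%N - u n| <= (c * q ^+ n * (1 - q ^+ m) / (1 - q))%:C.
    elim: m => [|m IH].
      by rewrite addn0 subrr normr0 expr0 subrr mulr0 mul0r.
    rewrite addnS (le_trans (ler_distD (u (n + m)%N) _ _))//.
    rewrite (le_trans (lerD (uq _) IH))// -rmorphD lecR le_eqVlt.
    apply/orP; left; apply/eqP.
    by rewrite exprD exprS; field; rewrite lt0r_neq0.
  apply: (le_trans um'); rewrite lecR ler_pM2r ?invr_gt0// ler_piMr//.
    by rewrite mulr_ge0 ?exprn_ge0.
  by rewrite gerBl exprn_ge0.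
have : cvg (u n @[n --> \oo]).
  apply: cauchy_cvg; apply: cauchy_exP => _ /gt0_complexP[e e0 ->].
  have : (c / (1 - q)) * q ^+ n @[n --> \oo] --> (0 : R).
    by apply: cvg_geometric; rewrite ger0_norm.
  move=> /cvgr0Pnorm_lt/(_ e e0)[N _ /(_ N (leqnn N))/= eN].
  exists (u N); exists N => //= n Nn; rewrite -ball_normE /= -(subnKC Nn).
  rewrite distrC (le_lt_trans (um _ _))// ltcR.
  by rewrite mulrAC; apply: le_lt_trans (ler_norm _) eN.
move=> /cvg_ex[l ul]; exists l; split=> // n.
apply/ler_addgt0Pr => e e0.
have /cvgrPdist_lt/(_ _ e0)[N _ uN] := ul.
rewrite (le_trans (ler_distD (u (n + N)%N) _ _))// addrC lerD//.
by apply/ltW/uN; rewrite /= leq_addl.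
Qed.

Lemma closure_normP (E : normedModType C) (K : set E) (x : E) :
  closure K x <-> forall e, 0 < e -> exists2 y, K y & `|x - y| < e.
Proof.
split=> [Kx e e0|Kx B /nbhs_ballP[e /= e0 eB]].
  have [y [Ky]] := Kx _ (nbhsx_ballx x e e0).
  by rewrite -ball_normE => xy; exists y.
have [y Ky xy] := Kx e e0; exists y; split=> //.
by apply: eB; rewrite -ball_normE.
Qed.

End Preliminaries.

(** * Inverting [1 - A] on a closed invariant subspace *)

Section Operators.
Context {R : realType}.
Local Notation C := R[i].

(** The lower bound gives injectivity, hence linearity of the set-theoretic inverse, and is also the
    norm bound of that inverse. *)
Lemma op_inverse (E : normedModType C) (D : 'L(E)) (c : C) :
    (forall x, `|x| <= c * `|D x|) -> (forall y, exists x, D x = y) ->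
  exists V : 'L(E), V * D = 1 /\ D * V = 1.
Proof.
move=> Dc Dsurj; have /choice[V DV] := Dsurj.
have Dinj x y : D x = D y -> x = y.
  move=> Dxy; apply/eqP; rewrite -subr_eq0 -normr_le0.
  by rewrite (le_trans (Dc _))// linearB /= Dxy subrr normr0 mulr0.
have VP : V \in @bounded_linear R E.
  rewrite inE; split=> [a x y|]; last by exists c => x; rewrite -{2}(DV x).
  by apply: Dinj; rewrite linearP /= !DV.
exists (BoundedOp VP); split; apply/opP => x; rewrite mulopE oneopE/=.
  by apply: Dinj; rewrite DV.
exact: DV.
Qed.

Section ClosedSubspace.
Context {E : completeNormedModType C}.
Variable F : @closed_subspace R E.

Lemma subspace_setP (x : subspace_type F) : subspace_set F (subspace_val x).
Proof. by have := subspace_valP x; rewrite inE. Qed.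

Lemma subspace_set0 : subspace_set F 0.
Proof. by have [/set_mem] := subspace_submod F. Qed.

Lemma subspace_set_linear (a : C) (x y : E) :
  subspace_set F x -> subspace_set F y -> subspace_set F (a *: x + y).
Proof.
by move=> Fx Fy; have [_ /(_ a x y)] := subspace_submod F; rewrite !inE; apply.
Qed.

Lemma subspace_setD (x y : E) :
  subspace_set F x -> subspace_set F y -> subspace_set F (x + y).
Proof. by move=> Fx Fy; rewrite -[x]scale1r; apply: subspace_set_linear. Qed.

Lemma subspace_setZ (a : C) (x : E) :
  subspace_set F x -> subspace_set F (a *: x).
Proof.
by move=> Fx; rewrite -[_ *: _]addr0; apply: subspace_set_linear => //;
  exact: subspace_set0.
Qed.

(** The equation [x = y + A x] is solved by iteration in the complete space [E]; closedness keeps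
    the limit in [F]. *)
Lemma restr_neumann (A : 'L(E)) (FA : op_invariant F A) (q : R) :
    0 <= q -> q < 1 ->
    (forall x, subspace_set F x -> `|A x| <= q%:C * `|x|) ->
  exists V : 'L(subspace_type F),
    V * (1 - restr FA) = 1 /\ (1 - restr FA) * V = 1.
Proof.
move=> q0 q1 Aq; have q1' : 0 < 1 - q by rewrite subr_gt0.
apply: (@op_inverse _ _ ((1 - q)^-1)%:C) => [x|y].
  rewrite fmorphV ler_pdivlMl; last by rewrite -[0]/(0%:C) ltcR.
  rewrite rmorphB mulrBl mul1r; apply: le_trans (lerB_dist _ _).
  by rewrite lerB// Aq//; exact: subspace_setP.
(* [u n] is the sum of A^i y over i < n, a partial sum of the Neumann series. *)
pose u n := iter n (fun x => subspace_val y + A x) 0.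
have Fu n : subspace_set F (u n).
  elim: n => [|n IH]; first exact: subspace_set0.
  by apply: subspace_setD; [exact: subspace_setP|exact: FA].
have [|l [ul _]] := @geometric_increments_cvg R E u (complex.Re `|y|) q q0 q1.
  elim=> [|n IH].
    by rewrite expr0 mulr1 -norm_complexE /u /= linear0 addr0 subr0.
  have -> : u n.+2 - u n.+1 = A (u n.+1 - u n).
    by rewrite linearB /u /= opprD addrACA subrr add0r.
  rewrite (le_trans (Aq _ _))//.
    by rewrite addrC -scaleN1r; apply: subspace_set_linear.
  by rewrite exprS mulrCA rmorphM ler_wpM2l ?ler0c.
have Fl : subspace_set F l.
  apply: (closed_cvg _ (@subspace_closed _ _ F) _ l ul).
  exact: nearW.
have Al : l = subspace_val y + A l.
  have ul1 : u n.+1 @[n --> \oo] --> l by rewrite (cvg_shiftS u).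
  apply: (cvg_unique _ ul1); first exact: norm_hausdorff.
  apply: cvgD; first exact: cvg_cst.
  by apply: cvg_comp ul _; exact: op_continuous.
exists (SubspaceElt (mem_set Fl)); apply: val_inj => /=.
by rewrite [X in X - _]Al addrK.
Qed.

End ClosedSubspace.
End Operators.

(** * Uniform boundedness on a closed subspace *)

Section UniformBoundedness.
Context {R : realType} {E : completeNormedModType R[i]}.
Variable F : @closed_subspace R E.
Local Notation nr x := (complex.Re `|x|).

Lemma Re_norm_le (x : E) (c : R) : (nr x <= c) = (`|x| <= c%:C).
Proof. by rewrite norm_complexE lecR. Qed.

Lemma Re_norm_ge0 (x : E) : 0 <= nr x.
Proof. by rewrite -ler0c -norm_complexE. Qed.

Lemma Re_normD (x y : E) : nr (x + y) <= nr x + nr y.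
Proof. by rewrite Re_norm_le rmorphD /= -!norm_complexE ler_normD. Qed.

Lemma Re_normN (x : E) : nr (- x) = nr x.
Proof. by rewrite normrN. Qed.

Lemma Re_normZ (a : R) (x : E) : nr (a%:C *: x) = `|a| * nr x.
Proof.
apply: complexI; rewrite rmorphM /= -!norm_complexE normrZ; congr (_ * _).
by rewrite normc_def /= expr0n addr0 sqrtr_sqr.
Qed.

(** [N] is the norm of [A] on [F], at least [M] because of [x0]. Since it is positive, some vector
    of the unit ball attains two thirds of it. *)
Lemma restricted_norm (A : 'L(E)) (M : R) (x0 : E) :
    0 < M -> subspace_set F x0 -> ~ (nr (A x0) <= M * nr x0) ->
  exists N : R, [/\ M <= N,
    forall x, subspace_set F x -> nr (A x) <= N * nr x &
    exists x, [/\ subspace_set F x, nr x <= 1 & 2 / 3 * N <= nr (A x)]].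
Proof.
move=> M0 Fx0 /negP; rewrite -ltNge => x0M.
pose B : set R := [set nr (A x) | x in [set x | subspace_set F x /\ nr x <= 1]].
have supB : has_sup B.
  split; first by exists (nr (A 0)), 0 => //; split;
    rewrite ?normr0//; exact: subspace_set0.
  exists (complex.Re (opnorm A)) => _ [x [Fx x1] <-].
  rewrite Re_norm_le RRe_real ?ger0_real ?opnorm_ge0//.
  rewrite (le_trans (le_opnorm A x))// -[leRHS]mulr1 ler_wpM2l ?opnorm_ge0//.
  by rewrite -[1]/(1%:C) -Re_norm_le.
have ABsup x : subspace_set F x -> nr (A x) <= sup B * nr x.
  move=> Fx; have [x0'|x0'] := eqVneq (nr x) 0.
    have /normr0_eq0-> : `|x| = 0 by rewrite norm_complexE x0'.
    by rewrite linear0 normr0 mulr0.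
  have nx0 : 0 < nr x by rewrite lt_neqAle eq_sym x0' Re_norm_ge0.
  rewrite -ler_pdivrMr// mulrC -[_^-1]ger0_norm ?invr_ge0 ?Re_norm_ge0//.
  rewrite -Re_normZ -linearZ; apply: sup_upper_bound => //.
  exists ((nr x)^-1%:C *: x) => //; split; first exact: subspace_setZ.
  by rewrite Re_normZ ger0_norm ?invr_ge0 ?Re_norm_ge0// mulVf.
have MB : M <= sup B.
  rewrite leNgt; apply/negP => BM.
  have := ABsup _ Fx0; have := Re_norm_ge0 x0; nra.
exists (sup B); split => //.
have [|_ [x [Fx x1] <-] Bx] := sup_adherent _ supB (eps := sup B / 3).
  by rewrite divr_gt0// (lt_le_trans M0).
by exists x; split => //; lra.
Qed.

(* Gliding hump (Sokal): move by +-3^-n along a near-maximiser of the n-th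
   operator. The library's Banach-Steinhaus theorem needs real scalars. *)
Theorem uniform_boundedness (AA : set 'L(E)) :
    (forall x, subspace_set F x ->
      exists M : R, forall A, AA A -> `|A x| <= M%:C) ->
  exists2 M : R, 0 <= M &
    forall A x, AA A -> subspace_set F x -> `|A x| <= M%:C * `|x|.
Proof.
move=> ptbnd; apply: contrapT => nbnd.
(* The factor 3^n offsets the step size 3^-n of the moves; the factor n + 1 forces divergence. *)
have step n : exists p : 'L(E) * R * E,
    [/\ AA p.1.1, n.+1%:R * 3 ^+ n <= p.1.2,
        forall x, subspace_set F x -> nr (p.1.1 x) <= p.1.2 * nr x &
        [/\ subspace_set F p.2, nr p.2 <= 1 & 2 / 3 * p.1.2 <= nr (p.1.1 p.2)]].
  have M0 : 0 < n.+1%:R * 3 ^+ n :> R by rewrite mulr_gt0 ?exprn_gt0.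
  apply: contrapT => nstep; apply: nbnd; exists (n.+1%:R * 3 ^+ n).
    exact: ltW.
  move=> A x AAA Fx; rewrite (norm_complexE x) -rmorphM -Re_norm_le.
  apply: contrapT => /(restricted_norm M0 Fx)[N [MN AN [y ?]]].
  by apply: nstep; exists (A, N, y); split.
have [p pP] := choice step.
pose A n := (p n).1.1; pose N n := (p n).1.2.
pose h n := (3^-1 ^+ n)%:C *: (p n).2.
(* Since [2 h] is the difference of [u + h] and [u - h], at least one sign gives an image under
   [A m] no smaller than that of [h m]; plus is taken when it works. *)
pose u := fix u n := if n is m.+1 then
  if nr (A m (h m)) <= nr (A m (u m + h m)) then u m + h m else u m - h m
  else 0.
have Fh n : subspace_set F (h n).
  by apply: subspace_setZ; have [_ _ _ []] := pP n.
have Fu n : subspace_set F (u n).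
  elim: n => [|n IH] /=; first exact: subspace_set0.
  case: ifP => _; apply: subspace_setD => //.
  by rewrite -scaleN1r; apply: subspace_setZ.
have q3 n : 0 <= 3^-1 ^+ n :> R by rewrite exprn_ge0.
have Au n : nr (A n (h n)) <= nr (A n (u n.+1)).
  rewrite /=; case: ifPn => //; rewrite -ltNge => Ah.
  have := Re_normD (A n (u n + h n)) (- A n (u n - h n)).
  rewrite Re_normN -linearB opprB [_ + (_ - _)]addrC addrA subrK -mulr2n.
  rewrite raddfMn /= normrMn raddfMn /= mulr2n; lra.
have uh n : nr (u n.+1 - u n) = nr (h n).
  by rewrite /=; case: ifP => _; rewrite addrAC subrr add0r ?Re_normN.
have [|||l [ul lu]] := @geometric_increments_cvg R E u 1 3^-1.
- by rewrite invr_ge0.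
- by rewrite invf_lt1// ltr1n.
- move=> n; rewrite -Re_norm_le uh Re_normZ ger0_norm// mulrC ler_pM//.
    exact: Re_norm_ge0.
  by have [_ _ _ []] := pP n.
have Fl : subspace_set F l.
  apply: (closed_cvg _ (@subspace_closed _ _ F) _ l ul).
  exact: nearW.
have [M lM] := ptbnd l Fl.
(* Here 6 is the inverse of 2/3 - 1/2: the hump contributes 2/3 of N_n 3^-n and later moves remove
   at most half of N_n 3^-n. *)
have [n nM] : exists n : nat, 6 * M < n.+1%:R.
  by exists (Num.truncn (6 * M)); exact: truncnS_gt.
have [AAn Nn AN [Fp p1 pN]] := pP n.
move: (u n.+1) (Fu n.+1) (Au n) (lu n.+1) => v Fv Av lv.
(* The moves after [v] total at most 3^-(n+1) / (1 - 1/3). *)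
have lv3 : nr (l - v) <= 2^-1 * 3^-1 ^+ n.
  rewrite Re_norm_le (le_trans lv)// lecR mul1r exprS le_eqVlt; apply/orP; left.
  by apply/eqP; field.
have tN : n.+1%:R <= N n * 3^-1 ^+ n.
  have e3 : 0 < 3 ^+ n :> R by rewrite exprn_gt0.
  by rewrite -(ler_pM2r e3) -mulrA -exprMn mulVf ?expr1n ?mulr1.
have N0 : 0 <= N n by rewrite (le_trans _ Nn)// mulr_ge0 ?exprn_ge0.
have lM' : nr (A n l) <= M by rewrite Re_norm_le lM.
have Alv := AN _ (subspace_setD Fl (subspace_setZ (-1) Fv)).
rewrite scaleN1r linearB -/(A n) -/(N n) /= in Alv.
have Avl := Re_normD (A n l) (- (A n l - A n v)).
rewrite Re_normN opprB addrC subrK in Avl.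
rewrite linearZ /= Re_normZ ger0_norm// in Av.
have := ler_wpM2l N0 lv3; have := ler_wpM2l (q3 n) pN.
by rewrite -/(A n) -/(N n); lra.
Qed.

End UniformBoundedness.

(** * Continuity of operator products and induction on convex hulls *)

Section OperatorLimits.
Context {R : realType} {E : normedModType R[i]}.
Local Notation C := R[i].

Lemma mulopZl (a : C) (A B : 'L(E)) : (a *: A) * B = a *: (A * B).
Proof. by apply/opP. Qed.

Lemma mulopZr (a : C) (A B : 'L(E)) : A * (a *: B) = a *: (A * B).
Proof. by apply/opP => x; rewrite scaleopE !mulopE scaleopE linearZ. Qed.

Lemma le_norm_op (A : 'L(E)) x : `|A x| <= `|A| * `|x|.
Proof. exact: le_opnorm. Qed.

Lemma norm_op_le (A : 'L(E)) (M : C) :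
  0 <= M -> (forall x, `|A x| <= M * `|x|) -> `|A| <= M.
Proof. exact: opnorm_le. Qed.

Lemma lipschitz_bound_continuous (V W : normedModType C) (f : V -> W) (c : C) :
  0 <= c -> (forall x y, `|f x - f y| <= c * `|x - y|) -> continuous f.
Proof.
move=> c0 fc x; apply/cvgrPdist_lt => e e0.
have c1 : 0 < c + 1 by rewrite ltr_wpDl.
have : \forall y \near x, `|x - y| < e / (c + 1).
  by apply: cvgr_dist_lt; [exact: cvg_id|rewrite divr_gt0].
apply: filterS => y xy; rewrite (le_lt_trans (fc _ _))//.
rewrite (@le_lt_trans _ _ ((c + 1) * `|x - y|))//.
  by rewrite ler_wpM2r ?lerDl.
by rewrite mulrC -ltr_pdivlMr.
Qed.

Lemma mulopl_continuous (B : 'L(E)) : continuous (fun A : 'L(E) => A * B).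
Proof.
apply: (@lipschitz_bound_continuous _ _ _ `|B|) => // A A'.
by rewrite -mulrBl mulrC opnormM.
Qed.

Lemma mulopr_continuous (B : 'L(E)) : continuous (fun A : 'L(E) => B * A).
Proof.
apply: (@lipschitz_bound_continuous _ _ _ `|B|) => // A A'.
by rewrite -mulrBr opnormM.
Qed.

Lemma closed_eq_op (f : 'L(E) -> 'L(E)) (B : 'L(E)) :
  continuous f -> closed [set A | f A = B].
Proof.
move=> fc; apply: (@preimage_closed _ _ f [set B]) => [A _|]; first exact: fc.
exact/accessible_closed_set1/hausdorff_accessible/norm_hausdorff.
Qed.

Lemma closed_commute (B : 'L(E)) : closed [set A | A * B = B * A].
Proof.
have -> : [set A | A * B = B * A] = [set A | A * B - B * A = 0].
  by apply/seteqP; split=> A /= => [->|/eqP]; rewrite ?subrr// subr_eq0 => /eqP.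
apply: (@closed_eq_op (fun A => A * B - B * A)) => A.
exact: cvgB (@mulopl_continuous B A) (@mulopr_continuous B A).
Qed.

Lemma convex_hull_ind (G K : set 'L(E)) :
    G `<=` K ->
    (forall (A B : 'L(E)) (t : C), 0 <= t -> t <= 1 -> K A -> K B ->
      K (t *: A + (1 - t) *: B)) ->
  convex_hull G `<=` K.
Proof.
move=> GK Kconv; apply: smallest_sub => // A B t /set_mem KA /set_mem KB.
by apply/mem_set/Kconv.
Qed.

Lemma convex_hull_conv (G : set 'L(E)) (A B : 'L(E)) (t : C) :
  0 <= t -> t <= 1 -> convex_hull G A -> convex_hull G B ->
  convex_hull G (t *: A + (1 - t) *: B).
Proof.
move=> t0 t1 GA GB K [Kconv GK].
have := Kconv A B (Itv01 t0 t1) (mem_set (GA _ (conj Kconv GK)))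
  (mem_set (GB _ (conj Kconv GK))).
by move/set_mem.
Qed.

End OperatorLimits.

(** * Ergodic nets and the mean ergodic projection *)

Section MeanErgodicity.
Context {R : realType} {S : nmodType} {E : normedModType R[i]}.
Local Notation C := R[i].
Variable T : S -> 'L(E).
Hypothesis T_rep : representation T.
Hypothesis T_bounded : bounded_fun T.
Local Notation co := (convex_hull (range T)).

(** Reduces a closed and convex condition on the closed hull to the operators [T s]. *)
Lemma clco_ind (K : set 'L(E)) :
    closed K -> (forall s, K (T s)) ->
    (forall (A B : 'L(E)) (t : C), 0 <= t -> t <= 1 -> K A -> K B ->
      K (t *: A + (1 - t) *: B)) ->
  clco T `<=` K.
Proof.
move=> Kcl KT Kconv; rewrite /clco closureE; apply: smallest_sub => //.
by apply: convex_hull_ind => // _ [s _ <-].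
Qed.

Lemma co_clco : co `<=` clco T. Proof. exact: subset_closure. Qed.

Lemma co_rep s : co (T s). Proof. by apply: sub_gen_smallest; exists s. Qed.

Lemma rep_comm s t : T s * T t = T t * T s.
Proof. by case: T_rep => _ TD; rewrite -!TD addrC. Qed.

(** By bilinearity, induction in each factor leaves only [T s * T t], which is [T (s + t)]. *)
Lemma co_mul (A B : 'L(E)) : co A -> co B -> co (A * B).
Proof.
move=> coA; move: B; apply: convex_hull_ind => [_ [t _ <-]|B B' a a0 a1 IB IB'].
  move: A coA; apply: convex_hull_ind => [_ [s _ <-]|A A' a a0 a1 IA IA'].
    by case: T_rep => _ TD; rewrite -TD; exact: co_rep.
  by rewrite mulrDl !mulopZl; exact: convex_hull_conv.
by rewrite mulrDr !mulopZr; exact: convex_hull_conv.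
Qed.

Lemma rep_norm_le : exists2 M : C, 0 <= M & forall s, `|T s| <= M.
Proof.
have [M M0 TM] := pinfty_ex_gt (@real0 C) T_bounded.
by exists M => [|s]; [exact: ltW|exact: TM].
Qed.

Lemma clco_norm_le : exists2 M : C, 0 <= M & forall A, clco T A -> `|A| <= M.
Proof.
have [M M0 TM] := rep_norm_le; exists M => //; apply: clco_ind => //.
  move=> A /closure_normP KA; apply/ler_addgt0Pr => e /KA[B /= BM AB].
  by rewrite -[A](subrK B) (le_trans (ler_normD _ _))// [leRHS]addrC lerD// ltW.
move=> A B t t0 t1 /= AM BM; rewrite (le_trans (ler_normD _ _))// !normrZ.
have t1' : 0 <= 1 - t by rewrite subr_ge0.
have -> : M = t * M + (1 - t) * M by rewrite -mulrDl subrKC mul1r.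
by rewrite !ger0_norm// lerD// ler_wpM2l.
Qed.

Lemma clco_comm_rep s (A : 'L(E)) : clco T A -> A * T s = T s * A.
Proof.
move: A; apply: clco_ind => [|t|A B t _ _ AT BT]; first exact: closed_commute.
  exact: rep_comm.
by rewrite /= mulrDl mulrDr !mulopZl !mulopZr AT BT.
Qed.

Lemma clco_comm (A B : 'L(E)) : clco T A -> clco T B -> A * B = B * A.
Proof.
move=> KA KB; apply/esym; move: B KB.
apply: clco_ind => [|t|B B' t _ _ AB AB'].
- exact: closed_commute.
- by rewrite clco_comm_rep.
- by rewrite /= mulrDl mulrDr !mulopZl !mulopZr AB AB'.
Qed.

(** [Q * P = P] is a closed convex condition on [Q], and commutativity of the closed hull supplies
    the other side. *)
Lemma mean_ergodic_projectionP (P : 'L(E)) :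
  mean_ergodic_projection T P <-> clco T P /\ forall s, T s * P = P.
Proof.
split=> [[KP Pz]|[KP TP]].
  by split=> // s; have [] := Pz _ (co_clco (co_rep s)).
split=> // Q KQ; rewrite (clco_comm KP KQ); suff -> : Q * P = P by [].
move: Q KQ; apply: clco_ind => [|//|A B t t0 t1 /= AP BP].
  by apply: closed_eq_op; exact: mulopl_continuous.
by rewrite mulrDl !mulopZl AP BP -scalerDl subrKC scale1r.
Qed.

Lemma mean_ergodic_projection_idem (P : 'L(E)) :
  mean_ergodic_projection T P -> P * P = P.
Proof. by move=> [KP /(_ _ KP)[]]. Qed.

Lemma mean_ergodic_projection_unique (P Q : 'L(E)) :
  mean_ergodic_projection T P -> mean_ergodic_projection T Q -> P = Q.
Proof.
by move=> [KP PK] [KQ QK]; have [<- _] := PK _ KQ; have [] := QK _ KP.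
Qed.

(** As [A j * P = P], the difference [A j - P] is [A j * (1 - P)]. The [Q] with [A j * (1 - Q)]
    tending to 0 form a closed convex set containing every [T s], hence [P]. *)
Lemma ergodic_net_cvg_projection (P : 'L(E)) (J : directed_set)
    (A : J -> 'L(E)) :
  mean_ergodic_projection T P -> ergodic_net T A -> A j @[j --> tails J] --> P.
Proof.
move=> Pz [KA TA]; have [M M0 KM] := clco_norm_le.
have TJ : Filter (nbhs (tails J)) := @filter_filter _ _ (tails_proper J).
suff AP : A j * (1 - P) @[j --> tails J] --> (0 : 'L(E)).
  apply/cvgrPdist_lt => e e0; move/cvgr0Pnorm_lt: AP => /(_ _ e0).
  apply: filterS => j; rewrite mulrBr mulr1.
  by have [_ PK] := Pz; have [-> _] := PK _ (KA j); rewrite distrC.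
have [KP _] := Pz; move: P KP {Pz}.
apply: (@clco_ind [set Q | A j * (1 - Q) @[j --> tails J] --> (0 : 'L(E))]).
(* Closedness rests on the bound [M] common to all [A j]; [M + 1] keeps the divisor positive. *)
- move=> Q /closure_normP KQ; apply/cvgr0Pnorm_lt => e e0.
  have M1 : 0 < M + 1 by rewrite ltr_wpDl.
  have e2 : 0 < e / 2 by rewrite divr_gt0.
  have eM : 0 < e / 2 / (M + 1) by rewrite divr_gt0.
  have [Q' /= /cvgr0Pnorm_lt/(_ _ e2) AQ' QQ'] := KQ _ eM.
  apply: filterS AQ' => j AjQ'.
  have -> : A j * (1 - Q) = A j * (1 - Q') + A j * (Q' - Q).
    by rewrite -mulrDr addrA subrK.
  rewrite (le_lt_trans (ler_normD _ _))// [e]splitr ltr_leD//.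
  rewrite (le_trans (opnormM _ _))// distrC.
  rewrite (@le_trans _ _ ((M + 1) * `|Q - Q'|))//.
    by rewrite ler_wpM2r// (le_trans (KM _ (KA j)))// lerDl.
  by rewrite mulrC -ler_pdivlMr// ltW.
- move=> s /=; under eq_fun do rewrite mulrBr mulr1 (clco_comm_rep _ (KA _)).
  by under eq_fun do rewrite -{1}[A _]mul1r -mulrBl; exact: TA.
- move=> Q Q' t _ _ /= AQ AQ'.
  have -> : (fun j => A j * (1 - (t *: Q + (1 - t) *: Q'))) =
      (fun j => t *: (A j * (1 - Q)) + (1 - t) *: (A j * (1 - Q'))).
    apply/funext => j; rewrite -!mulopZr -mulrDr; congr (_ * _).
    rewrite !scalerBr addrACA -opprD -scalerDl subrKC scale1r; congr (_ - _).
  have := cvgD (cvgZl_tmp (k := t) AQ) (cvgZl_tmp (k := 1 - t) AQ').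
  by rewrite !scaler0 addr0 => AQt; exact: AQt.
Qed.

Lemma ergodic_net_lim (J : directed_set) (A : J -> 'L(E)) (P : 'L(E)) :
  ergodic_net T A -> A j @[j --> tails J] --> P -> mean_ergodic_projection T P.
Proof.
move=> [KA TA] AP; apply/mean_ergodic_projectionP.
have TJ : ProperFilter (nbhs (tails J)) := tails_proper J.
split=> [|s].
  apply: (@closed_cvg _ _ _ TJ A (clco T)) AP; first exact: closed_closure.
  exact: nearW.
have /eqP : (1 - T s) * P = 0.
  apply/esym; apply: (cvg_unique _ (TA s)); first exact: norm_hausdorff.
  exact: (cvg_comp _ _ AP (@mulopr_continuous _ _ (1 - T s) P)).
by rewrite mulrBl mul1r subr_eq0 => /eqP/esym.
Qed.

Lemma mean_ergodic_net (P : 'L(E)) : mean_ergodic_projection T P ->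
  exists (J : directed_set) (A : J -> 'L(E)),
    ergodic_net T A /\ net_converges A.
Proof.
move=> /mean_ergodic_projectionP[KP TP].
(* The constant net [P] over a one-point index set. *)
pose J := @DirectedSet unit (fun _ _ => True) (fun _ => I) (fun _ _ _ _ _ => I)
  (inhabits tt) (fun _ _ => ex_intro _ tt (conj I I)).
exists J, (fun=> P).
have TJ : ProperFilter (nbhs (tails J)) := tails_proper J.
split; last by exists P; exact: cvg_cst.
split=> // s; rewrite mulrBl mul1r TP subrr; exact: cvg_cst.
Qed.

Definition cesaro (s : S) (n : nat) : 'L(E) :=
  (n.+1%:R^-1 : C) *: \sum_(i < n.+1) T (s *+ i).

Lemma co_cesaro s n : co (cesaro s n).
Proof.
elim: n => [|n IH].
  by rewrite /cesaro big_ord1 invr1 scale1r; exact: co_rep.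
have n0 k : k.+1%:R != 0 :> C by rewrite pnatr_eq0.
(* The old mean gets weight (n+1)/(n+2), the new term the remaining 1/(n+2). *)
have -> : cesaro s n.+1 = (n.+1%:R / n.+2%:R : C) *: cesaro s n +
    (1 - (n.+1%:R / n.+2%:R : C)) *: T (s *+ n.+1).
  rewrite /cesaro [in LHS]big_ord_recr scalerDr; congr (_ + _).
    by rewrite scalerA mulrAC mulfV// mul1r.
  congr (_ *: _); apply: (mulIf (n0 n.+1)).
  by rewrite mulrBl mul1r mulfVK// mulVf// -natrB// subSnn.
apply: convex_hull_conv => //; last exact: co_rep.
by rewrite ler_pdivrMr// mul1r ler_nat.
Qed.

Lemma rep_telescope s n : (1 - T s) * \sum_(i < n) T (s *+ i) = 1 - T (s *+ n).
Proof.
have [T0 TD] := T_rep; elim: n => [|n IH].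
  by rewrite big_ord0 mulr0 T0 subrr.
by rewrite big_ord_recr mulrDr IH mulrBl mul1r -TD -mulrS addrA subrK.
Qed.

Lemma ergodic_net_exists : exists (J : directed_set) (A : J -> 'L(E)),
  ergodic_net T A /\ forall j, co (A j).
Proof.
have [M M0 KM] := clco_norm_le; have [T0 TD] := T_rep.
(* Ordered by divisibility, the convex hull is directed as it is commutative;
   it is an ergodic net because it contains the Cesaro means. *)
pose J_le (A B : {A | co A}) := exists2 Q, co Q & sval B = Q * sval A.
have J_refl A : J_le A A.
  by exists 1; rewrite ?mul1r// -T0; exact: co_rep.
have J_trans A B D : J_le A B -> J_le B D -> J_le A D.
  move=> [Q KQ BA] [Q' KQ' DB]; exists (Q' * Q); first exact: co_mul.
  by rewrite DB BA mulrA.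
have J_ub (A B : {A | co A}) : exists D, J_le A D /\ J_le B D.
  exists (exist co _ (co_mul (svalP A) (svalP B))); split.
    exists (sval B); first exact: svalP.
    exact: clco_comm (co_clco (svalP A)) (co_clco (svalP B)).
  by exists (sval A); first exact: svalP.
pose J := DirectedSet J_refl J_trans (inhabits (exist co _ (co_rep 0))) J_ub.
exists J, sval; split; last exact: svalP.
split=> [j|s]; first exact/co_clco/svalP.
have TJ : Filter (nbhs (tails J)) := @filter_filter _ _ (tails_proper J).
apply/cvgr0Pnorm_lt => e e0.
have [r r0 er] := gt0_complexP e0.
(* [m] bounds the norm of [Q * (1 - T (s *+ n.+1))] for [Q] in the hull. Past the Cesaro mean of
   index [n], net elements are [Q * cesaro s n], and telescoping leaves at most m/(n+1). *)
have [m m0 Mm] : exists2 m : R, 0 <= m & M * (1 + M) = m%:C.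
  by apply: ge0_complexP; rewrite mulr_ge0// addr_ge0.
have [n nm] : exists n : nat, m / r < n.+1%:R.
  by exists (Num.truncn (m / r)); exact: truncnS_gt.
exists (exist co _ (co_cesaro s n)) => // j [Q KQ /= ->].
rewrite mulrA.
have -> : (1 - T s) * Q = Q * (1 - T s).
  by rewrite mulrBl mulrBr mul1r mulr1 (clco_comm_rep _ (co_clco KQ)).
rewrite -mulrA mulopZr rep_telescope.
rewrite (le_lt_trans (opnormM _ _))// normrZ mulrCA.
rewrite ger0_norm ?invr_ge0// ltr_pdivrMl// er.
rewrite (@le_lt_trans _ _ (m%:C))//; last first.
  rewrite -[n.+1%:R](rmorph_nat (@real_complex R)) -rmorphM ltcR.
  by rewrite -ltr_pdivrMr.
rewrite -Mm ler_pM//; first exact/KM/co_clco.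
rewrite (le_trans (ler_normB _ _))// lerD//; last first.
  exact: KM _ (co_clco (co_rep _)).
by apply: norm_op_le => // x; rewrite mul1r.
Qed.

End MeanErgodicity.

(** * Sums of families of subspaces *)

Section SubspaceSums.
Context {R : realType} {E : normedModType R[i]}.
Local Notation C := R[i].

Lemma subspace_sum_sub (I : Type) (F : I -> set E) (G : set E) :
    G 0 -> (forall x y, G x -> G y -> G (x + y)) -> (forall i, F i `<=` G) ->
  subspace_sum F `<=` G.
Proof.
move=> G0 GD FG _ [n [i [v [Fv ->]]]].
by apply: big_ind => // k _; exact: FG (Fv k).
Qed.

Lemma sub_subspace_sum (I : Type) (F : I -> set E) i : F i `<=` subspace_sum F.
Proof.
by move=> x Fx; exists 1%N, (fun=> i), (fun=> x); split; rewrite ?big_ord1.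
Qed.

Lemma subspace_sum_submod (I : Type) (F : I -> set E) :
    (forall i a x, F i x -> F i (a *: x)) ->
  submod_closed (mem (subspace_sum F) : {pred E}).
Proof.
move=> FZ; split.
  apply/mem_set; exists 0%N.
  (* [I] may be empty, so the empty sum is indexed by the empty function. *)
  exists (fun k : 'I_0 => False_rect I (notF (ltn_ord k))), (fun=> 0).
  by split=> [[]//|]; rewrite big_ord0.
move=> a _ _ /set_mem[n [i [v [Fv ->]]]] /set_mem[m [j [w [Fw ->]]]].
apply/mem_set; exists (n + m)%N.
exists (fun k : 'I_(n + m) =>
  match fintype.split k with inl l => i l | inr l => j l end).
exists (fun k : 'I_(n + m) =>
  match fintype.split k with inl l => a *: v l | inr l => w l end).
split=> [k|]; first by case: fintype.split => l; [exact: FZ|exact: Fw].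
rewrite big_split_ord scaler_sumr; congr (_ + _); apply: eq_bigr => k _.
  by rewrite (unsplitK (inl k)).
by rewrite (unsplitK (inr k)).
Qed.

Lemma range_op_scale (A : 'L(E)) (a : C) (x : E) :
  range A x -> range A (a *: x).
Proof. by move=> [y _ <-]; exists (a *: y); rewrite // linearZ. Qed.

End SubspaceSums.

(** * Poles, kernels of witnesses and the range of [1 - T] *)

Section Restrictions.
Context {R : realType} {S : nmodType} {E : completeNormedModType R[i]}.
Local Notation C := R[i].
Variable T : S -> 'L(E).
Hypothesis T_rep : representation T.
Hypothesis T_bounded : bounded_fun T.
Local Notation co := (convex_hull (range T)).
Local Notation U PT := (restr_rep (fun s => op_ker_invariant (PT s))).

Lemma rgE : rg T (fun=> 1) = subspace_sum (fun s => range (1 - T s)).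
Proof.
by rewrite /rg; congr subspace_sum; apply/funext => s; rewrite scale1r.
Qed.

Lemma rg_submod : submod_closed (mem (rg T (fun=> 1)) : {pred E}).
Proof. by apply: subspace_sum_submod => s a x; exact: range_op_scale. Qed.

(** A convex combination involves only finitely many semigroup elements; for this reason the ergodic
    net built above lies in the hull itself, not merely in its closure. *)
Lemma co_range (A : 'L(E)) : co A ->
  exists (n : nat) (s : 'I_n -> S), (0 < n)%N /\
    forall x, subspace_sum (fun k => range (1 - T (s k))) ((1 - A) x).
Proof.
move: A; apply: convex_hull_ind => [_ [s _ <-]|A B t _ _].
  exists 1%N, (fun=> s); split=> // x.
  by apply: (sub_subspace_sum (i := ord0)); exists x.
move=> [n [s [n0 sA]]] [m [s' [m0 s'B]]].
exists (n + m)%N, (fun k : 'I_(n + m) =>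
  match fintype.split k with inl l => s l | inr l => s' l end).
split=> [|x]; first by rewrite ltn_addr.
set F := fun k => _.
have [F0 FL] : submod_closed (mem (subspace_sum F) : {pred E}).
  by apply: subspace_sum_submod => k a y; exact: range_op_scale.
have FD y z : subspace_sum F y -> subspace_sum F z -> subspace_sum F (y + z).
  move=> /mem_set Fy /mem_set Fz; apply/set_mem.
  by have := FL 1 _ _ Fy Fz; rewrite scale1r.
have FZ a y : subspace_sum F y -> subspace_sum F (a *: y).
  move=> /mem_set Fy; apply/set_mem.
  by have := FL a _ _ Fy F0; rewrite addr0.
have -> : (1 - (t *: A + (1 - t) *: B)) x =
    t *: (1 - A) x + (1 - t) *: (1 - B) x.
  rewrite -!scaleopE -addopE; congr (op_fun _ x).
  by rewrite !scalerBr addrACA -opprD -scalerDl subrKC scale1r.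
apply: (FD); apply: FZ.
  move: (sA x); apply: subspace_sum_sub; [exact: set_mem|exact: FD|].
  move=> k y sy; apply: (sub_subspace_sum (i := lshift m k)); rewrite /F.
  by rewrite (unsplitK (inl k)).
move: (s'B x); apply: subspace_sum_sub; [exact: set_mem|exact: FD|].
move=> k y sy; apply: (sub_subspace_sum (i := rshift n k)); rewrite /F.
by rewrite (unsplitK (inr k)).
Qed.

Lemma rg_sub_finite (n : nat) (s : 'I_n -> S) :
  subspace_sum (fun k => range (1 - T (s k))) `<=` rg T (fun=> 1).
Proof.
have [F0 FL] := rg_submod.
apply: subspace_sum_sub => [|x y /mem_set Fx /mem_set Fy|k x sx].
- exact: set_mem.
- by apply/set_mem; have := FL 1 _ _ Fx Fy; rewrite scale1r.
- by rewrite rgE; exact: (sub_subspace_sum (i := s k)).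
Qed.

Lemma co_commute (P : 'L(E)) : (forall s, P * T s = T s * P) ->
  forall A, co A -> P * A = A * P.
Proof.
move=> PT A /co_clco KA; apply/esym; move: A KA.
apply: clco_ind => [|s|A B t _ _ PA PB]; first exact: closed_commute.
  by rewrite PT.
by rewrite /= mulrDl mulrDr !mulopZl !mulopZr PA PB.
Qed.

Lemma rg_sub_ker (P : 'L(E)) :
  projection_onto P (fix_space T) -> (forall s, P * T s = T s * P) ->
  forall y, rg T (fun=> 1) y -> P y = 0.
Proof.
move=> [PP rP] PT; rewrite rgE; apply: subspace_sum_sub.
- exact: linear0.
- by move=> x y Px Py; rewrite linearD /= Px Py addr0.
- move=> s _ [x _ <-].
  have : range P (P x) by exists x.
  rewrite rP => /(_ s); rewrite scale1r => TPx.
  have -> : P ((1 - T s) x) = P x - (P * T s) x by exact: (linearB P).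
  by rewrite PT mulopE TPx subrr.
Qed.

Lemma witness_ker_finite_rg (P : 'L(E)) : witnesses_pole T (fun=> 1) P ->
  exists (n : nat) (s : 'I_n -> S), (0 < n)%N /\
    forall y, P y = 0 -> subspace_sum (fun k => range (1 - T (s k))) y.
Proof.
move=> [_ [PT nspec]].
have [J [A [[KA TA] coA]]] := ergodic_net_exists T_rep T_bounded.
have TJ : ProperFilter (nbhs (tails J)) := tails_proper J.
pose FA j := op_ker_invariant (co_commute PT (coA j)).
(* A left ideal containing all 1 - T_s|, hence everything: A_j| tends to 0. *)
pose I : set 'L(subspace_type (op_ker P)) :=
  [set B | B * restr (FA j) @[j --> tails J] -->
           (0 : 'L(subspace_type (op_ker P)))].
have I_ideal : left_ideal I.
  split=> [|B B' IB IB'|B B' IB']; rewrite /I /=.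
  - by under eq_fun do rewrite mul0r; exact: cvg_cst.
  - under eq_fun do rewrite mulrDl; rewrite -[0](addr0 0).
    exact: cvgD IB IB'.
  - under eq_fun do rewrite -mulrA; rewrite -[0](mulr0 B).
    exact: (cvg_comp _ _ IB' (@mulopr_continuous _ _ B 0)).
have IT s : I (1 - U PT s).
  apply/cvgr0Pnorm_lt => e e0; move/cvgr0Pnorm_lt: (TA s) => /(_ _ e0).
  apply: filterS => j; apply: le_lt_trans; apply: norm_op_le => // x.
  exact: (le_norm_op ((1 - T s) * A j) (subspace_val x)).
have I1 : I 1.
  pose gens := [set (1 : C) *: (1 : 'L(subspace_type (op_ker P))) - U PT s |
    s in [set: S]].
  (* The constant 1 is a unitary character, so [nspec] can only mean that the ideal is
     everything. *)
  have gensT : smallest (@left_ideal _) gens = setT.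
    apply: contrapT => nT; apply: nspec; split=> //.
    by split=> *; rewrite ?normr1 ?mulr1.
  have : smallest (@left_ideal _) gens 1 by rewrite gensT.
  by apply; split=> // _ [s _ <-]; rewrite scale1r.
have /cvgr0Pnorm_lt/(_ (2^-1)%:C) : restr (FA j) @[j --> tails J] -->
    (0 : 'L(subspace_type (op_ker P))).
  by move: I1; rewrite /I /=; under eq_fun do rewrite mul1r.
move=> /(_ _)/filter_ex[|j Aj]; first by rewrite -[0]/(0%:C) ltcR invr_gt0.
have [||x /= Px|V [_ AV]] := @restr_neumann _ _ _ _ (FA j) (2^-1).
- by rewrite invr_ge0.
- by rewrite invf_lt1 ?ltr1n.
- have /mem_set Fx : subspace_set (op_ker P) x := Px.
  rewrite (le_trans (le_norm_op (restr (FA j)) (SubspaceElt Fx)))//.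
  by rewrite ler_wpM2r// ltW.
have [n [s [n0 sA]]] := co_range (coA j).
exists n, s; split=> // y Py.
have /mem_set Fy : subspace_set (op_ker P) y := Py.
(* Evaluated at [y], [AV] exhibits [y] as a value of [1 - A j]. *)
have /(congr1 (fun B : 'L(_) => subspace_val (B (SubspaceElt Fy)))) /= := AV.
by move=> <-; exact: sA.
Qed.

Lemma witness_rg_ker (P : 'L(E)) : witnesses_pole T (fun=> 1) P ->
  rg T (fun=> 1) = [set y | P y = 0].
Proof.
move=> wP; apply/seteqP; split=> y /=.
  by have [PP [PT _]] := wP; exact: rg_sub_ker.
by have [n [s [_ Ps]]] := witness_ker_finite_rg wP => /Ps /rg_sub_finite.
Qed.

(** Both projections have range [fix_space T] and kernel [rg T (fun=> 1)], which determines them. *)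
Lemma witness_unique (P Q : 'L(E)) :
  witnesses_pole T (fun=> 1) P -> witnesses_pole T (fun=> 1) Q -> P = Q.
Proof.
move=> wP wQ; have [[PP rP] _] := wP; have [[QQ rQ] _] := wQ.
apply/opP => x.
have : [set y | Q y = 0] (x - P x).
  rewrite -witness_rg_ker// (witness_rg_ker wP)/= linearB /=.
  by rewrite -mulopE PP subrr.
rewrite /= linearB /= => /eqP; rewrite subr_eq0 => /eqP ->.
have : range Q (P x) by rewrite rQ -rP; exists x.
by move=> [z _ <-]; rewrite -mulopE QQ.
Qed.

Lemma mean_ergodic_projection_witness (P : 'L(E)) :
  mean_ergodic_projection T P -> witnesses_pole T (fun=> 1) P.
Proof.
move=> Pz; have PP := mean_ergodic_projection_idem Pz.
have [KP TP] := (mean_ergodic_projectionP T_rep P).1 Pz.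
split.
  split=> //; apply/seteqP; split=> [_ [x _ <-] s|x Tx].
    by rewrite scale1r -mulopE TP.
  (* [A x = x] is a closed convex condition on [A], true of every [T s] when [x] is fixed. *)
  exists x => //; move: P KP {Pz PP TP}.
  apply: clco_ind => [|s|A B t _ _ /= Ax Bx].
  - apply: (@preimage_closed _ _ (fun A : 'L(E) => A x) [set x]) => [A _|].
      apply: (@lipschitz_bound_continuous _ _ _ _ `|x|) => // {}A B.
      by rewrite mulrC; exact: (le_norm_op (A - B)).
    exact/accessible_closed_set1/hausdorff_accessible/norm_hausdorff.
  - by rewrite Tx scale1r.
  - rewrite -[LHS]/(t *: A x + (1 - t) *: B x) Ax Bx.
    by rewrite -scalerDl subrKC scale1r.
have PT s : P * T s = T s * P by exact: clco_comm_rep.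
exists PT => -[_]; apply; apply/seteqP; split=> // B _ I [I_ideal IT].
have [I0 ID IM] := I_ideal.
(* On the kernel of [P], [A] agrees with [- (P - A)], so it is at least halving there. *)
have /closure_normP/(_ (2^-1)%:C)[|A coA PA] := KP.
  by rewrite -[0]/(0%:C) ltcR invr_gt0.
have FA := op_ker_invariant (co_commute PT coA).
have [||x Px|V [VA _]] := @restr_neumann _ _ _ _ FA (2^-1).
- by rewrite invr_ge0.
- by rewrite invf_lt1 ?ltr1n.
- have -> : A x = - ((P - A) x) by rewrite addopE oppopE Px add0r opprK.
  by rewrite normrN (le_trans (le_norm_op _ _))// ler_wpM2r// ltW.
suff IA : I (1 - restr FA) by rewrite -[B]mulr1 -VA mulrA; exact: IM.
(* The induction carries an operator [B] acting like [A], because [restr] would require an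
   invariance proof at each stage. *)
have : exists2 B : 'L(subspace_type (op_ker P)),
  forall x, subspace_val (B x) = A (subspace_val x) & I (1 - B).
  move: A coA {PA FA VA}.
  apply: convex_hull_ind => [_ [s _ <-]|A A' t _ _ [B1 B1A IB1] [B2 B2A IB2]].
    exists (U PT s) => //; apply: IT.
    by exists s; rewrite // scale1r.
  exists (t *: B1 + (1 - t) *: B2) => [x|].
    by rewrite !addopE !scaleopE -B1A -B2A.
  (* A left ideal absorbs ring elements, so scalars enter as multiples of [1]. *)
  have -> : 1 - (t *: B1 + (1 - t) *: B2) =
      (t *: (1 : 'L(subspace_type (op_ker P)))) * (1 - B1) +
      ((1 - t) *: (1 : 'L(subspace_type (op_ker P)))) * (1 - B2).
    rewrite !mulopZl !mul1r !scalerBr addrACA -opprD -scalerDl.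
    by rewrite subrKC scale1r.
  by apply: ID; exact: IM.
move=> [B' B'A]; have -> // : B' = restr FA.
by apply/opP => x; apply: val_inj; exact: B'A.
Qed.

(** * From a closed, finitely generated range to mean ergodicity *)

Section ClosedRange.
Variables (n : nat) (s : 'I_n -> S).
Hypothesis rg_closed : closed (rg T (fun=> 1)).
Hypothesis rg_fin :
  rg T (fun=> 1) = subspace_sum (fun k => range (1 - T (s k))).
Let G := ClosedSubspace rg_submod rg_closed.

Lemma co_small_on_rg (e : R) : 0 < e ->
  exists2 A : 'L(E), co A & forall y, rg T (fun=> 1) y -> `|A y| <= e%:C * `|y|.
Proof.
move=> e0; pose AA := [set A : 'L(E) | forall k, `|A * (1 - T (s k))| <= 1].
(* The uniform bound replaces the open mapping theorem for
   (x_k) |-> \sum_k (x_k - T_(s_k) x_k). *)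
have [y|M M0 AM] := @uniform_boundedness _ _ G AA.
  (* If [y] is a sum of vectors [(1 - T (s k)) x], the sum of the norms of these [x] bounds [A y]
     for all [A] in [AA]. *)
  rewrite /= rg_fin; move: y; apply: subspace_sum_sub.
  - by exists 0 => A _; rewrite linear0 normr0.
  - move=> x y [M AM] [N AN]; exists (M + N) => A AAA.
    by rewrite linearD rmorphD (le_trans (ler_normD _ _))// lerD ?AM ?AN.
  - move=> k _ [x _ <-]; exists (complex.Re `|x|) => A /(_ k) Ak.
    rewrite -norm_complexE -mulopE (le_trans (le_norm_op _ _))//.
    by rewrite -[leRHS]mul1r ler_wpM2r.
have M1 : 0 < M + 1 by rewrite ltr_wpDl.
have d0 : 0 < e / (M + 1) by rewrite divr_gt0.
have dC0 : 0 < (e / (M + 1))%:C by rewrite -[0]/(0%:C) ltcR.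
have [J [A [[KA TA] coA]]] := ergodic_net_exists T_rep T_bounded.
have TJ : ProperFilter (nbhs (tails J)) := tails_proper J.
have : \forall j \near tails J, forall k,
    `|(1 - T (s k)) * A j| < (e / (M + 1))%:C.
  apply: filter_forall => k.
  by move/cvgr0Pnorm_lt: (TA (s k)) => /(_ _ dC0).
move=> /filter_ex[j Aj]; exists (A j) => // y Gy.
(* After rescaling, the uniform bound gives the factor M e/(M+1), at most e. *)
have AAj : AA ((e / (M + 1))%:C^-1 *: A j).
  move=> k; rewrite mulopZl normrZ [`|_^-1|]ger0_norm ?invr_ge0 ?(ltW dC0)//.
  rewrite ler_pdivrMl// mulr1 mulrBr mulr1 (clco_comm_rep T_rep _ (KA j)).
  by rewrite -{1}[A j]mul1r -mulrBl ltW.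
have := AM _ y AAj Gy.
rewrite scaleopE normrZ [`|_^-1|]ger0_norm ?invr_ge0 ?(ltW dC0)//.
rewrite ler_pdivrMl// => /le_trans; apply.
rewrite mulrA -rmorphM ler_wpM2r// lecR.
by rewrite mulrAC ler_pdivrMr// ler_wpM2l ?lerDl// ltW.
Qed.

Lemma closed_range_mean_ergodic : uniformly_mean_ergodic T.
Proof.
have [|A coA Aq] := @co_small_on_rg (2^-1); first by rewrite invr_gt0.
have rA B x : co B -> rg T (fun=> 1) ((1 - B) x).
  by move=> /co_range[m [s' [_ /(_ x)]]]; exact: rg_sub_finite.
have GA : op_invariant G A.
  move=> y /= Gy; have -> : A y = y + (-1) *: (1 - A) y.
    by rewrite scaleN1r addopE oppopE opprB addrC subrK.
  apply: (@subspace_setD _ _ G) => //.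
  by apply: (@subspace_setZ _ _ G); exact: rA.
have [||V [VA AV]] := @restr_neumann _ _ G A GA (2^-1) _ _ Aq.
- by rewrite invr_ge0.
- by rewrite invf_lt1 ?ltr1n.
(* [1 - A] maps [E] into the range and [V] inverts it there, so [Q] is the projection onto the range
   and [1 - Q] the candidate for [P]. *)
pose Q x := subspace_val
  (V (SubspaceElt (mem_set (rA A x coA) : _ \in in_subspace G))).
have QP : Q \in @bounded_linear R E.
  rewrite inE; split=> [a x y|].
    rewrite /Q -[RHS]/(subspace_val (a *: V _ + V _)) -linearP.
    congr (subspace_val (V _)); apply: val_inj; exact: (linearP (1 - A)).
  exists (`|V| * `|1 - A|) => x; rewrite -mulrA.
  by rewrite (le_trans (le_norm_op V _))// ler_wpM2l// (le_norm_op (1 - A)).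
pose P : 'L(E) := 1 - BoundedOp QP.
have PE x : P x = x - Q x by [].
have GQ x : rg T (fun=> 1) (Q x) by exact: (@subspace_setP _ _ G).
have APx x : (1 - A) (P x) = 0.
  rewrite PE linearB /=; apply/eqP; rewrite subr_eq0; apply/eqP.
  have /(congr1 (fun B : 'L(_) => subspace_val (B (SubspaceElt
    (mem_set (rA A x coA) : _ \in in_subspace G))))) /= := AV.
  by move=> <-.
have TP t : T t * P = P.
  (* [z] lies in the range and is fixed by [A], since [1 - A] commutes with [1 - T t] and kills
     [P x]; as [A] at least halves norms there, [z = 0]. *)
  apply/opP => x; pose z := (1 - T t) (P x).
  have Az : A z = z.
    have : (1 - A) z = 0.
      rewrite /z -mulopE -[(1 - A) * _]/((1 - A) * (1 - T t)).
      have -> : (1 - A) * (1 - T t) = (1 - T t) * (1 - A).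
        rewrite !mulrBl !mulrBr !mul1r !mulr1.
        rewrite (clco_comm_rep T_rep _ (co_clco coA)).
        by rewrite !opprB addrACA [RHS]addrACA; congr (_ + _); exact: addrC.
      by rewrite mulopE APx linear0.
    by rewrite addopE oppopE => /eqP; rewrite subr_eq0 => /eqP/esym.
  have z0 : z = 0.
    apply/eqP; rewrite -normr_le0; have := Aq z (rA _ _ (@co_rep _ _ _ T t)).
    rewrite Az [`|z|]norm_complexE -rmorphM lecR => zz.
    by rewrite -[0]/(0%:C) lecR; lra.
  by move/eqP: z0; rewrite /z addopE oppopE subr_eq0 => /eqP/esym.
exists P; apply/mean_ergodic_projectionP => //; split=> //.
apply/closure_normP => _ /gt0_complexP[e e0 ->].
have [c c0 Pc] := ge0_complexP (normr_ge0 (BoundedOp QP)).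
have c1 : 0 < c + 1 by rewrite ltr_wpDl.
(* As [B * P = P], the difference [P - B] is [- (B * Q)], small because [Q] has norm [c] and values
   in the range. *)
have [|B coB Bq] := @co_small_on_rg (e / (c + 1)); first by rewrite divr_gt0.
exists B => //.
have BP : B * P = P.
  move: B coB {Bq}; apply: convex_hull_ind => [_ [t _ <-]//|B B' t _ _ BP B'P].
  by rewrite mulrDl !mulopZl BP B'P -scalerDl subrKC scale1r.
have -> : P - B = - (B * BoundedOp QP).
  by rewrite -{1}BP -{2}[B]mulr1 -mulrBr /P addrAC subrr add0r mulrN.
rewrite normrN (@le_lt_trans _ _ ((e / (c + 1)) * c)%:C)//.
  apply: norm_op_le; first by rewrite ler0c mulr_ge0// ltW// divr_gt0.
  move=> x; rewrite mulopE (le_trans (Bq _ (GQ x)))//.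
  rewrite [(_ * c)%:C]rmorphM /= -Pc -mulrA.
  rewrite ler_wpM2l ?ler0c ?divr_ge0 ?(ltW e0) ?(ltW c1)//.
  exact: (le_norm_op (BoundedOp QP)).
by rewrite ltcR mulrAC ltr_pdivrMr// ltr_pM2l// ltrDl.
Qed.

End ClosedRange.
End Restrictions.

(** * The cycle of implications and the three consequences *)

Theorem theorem3p3 (R : realType) (S : nmodType)
    (E : completeNormedModType R[i]) (T : S -> 'L(E))
    (T_rep : representation T) (T_bounded : bounded_fun T) :
  [<-> uniformly_mean_ergodic T;
       exists (J : directed_set) (A : J -> 'L(E)),
         ergodic_net T A /\ net_converges A;
       forall (J : directed_set) (A : J -> 'L(E)),
         ergodic_net T A -> net_converges A;
       pole T (fun=> 1);
       closed (rg T (fun=> 1)) /\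
         exists (n : nat) (s : 'I_n -> S), (0 < n)%N /\
           rg T (fun=> 1) =
             subspace_sum (fun k : 'I_n => range (1 - T (s k) : 'L(E)))]
  /\
  (uniformly_mean_ergodic T ->
   exists P : 'L(E),
   [/\ unique (mean_ergodic_projection T) P,
       forall (J : directed_set) (A : J -> 'L(E)),
         ergodic_net T A -> A j @[j --> tails J] --> P,
       unique (witnesses_pole T (fun=> 1)) P &
       direct_sum (fix_space T) (rg T (fun=> 1))]).
Proof.
(* The step from (c) to (d) below passes through (a). *)
have cd : uniformly_mean_ergodic T -> pole T (fun=> 1).
  move=> [P Pz]; split; first by split=> *; rewrite ?normr1 ?mulr1.
  by exists P; exact: mean_ergodic_projection_witness.
split; last first.
  move=> [P Pz]; have wP := mean_ergodic_projection_witness T_rep Pz.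
  exists P; split=> [|J A||].
  - by split=> // Q; exact: mean_ergodic_projection_unique.
  - exact: ergodic_net_cvg_projection.
  - by split=> // Q; exact: witness_unique.
  - have [[PP rP] _] := wP; rewrite (witness_rg_ker T_rep T_bounded wP); split.
      rewrite -[fix_space T]rP; apply/seteqP; split=> [_ [[y _ <-]]|_ ->] /=.
        by rewrite -mulopE PP.
      by rewrite linear0; split=> //; exists 0; rewrite ?linear0.
    move=> x; exists (P x), (x - P x); split.
    + by rewrite -[fix_space T]rP; exists x.
    + by rewrite /= linearB /= -mulopE PP subrr.
    + by rewrite subrKC.
split; first by move=> [P]; exact: mean_ergodic_net.
split.
  (* The limit of one ergodic net is the mean ergodic projection, to which every ergodic net
     converges. *)
  move=> [J [A [nA [P AP]]]] J' A' nA'; exists P.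
  by apply: ergodic_net_cvg_projection nA' => //; exact: ergodic_net_lim AP.
split.
  move=> cvA; have [J [A [nA _]]] := ergodic_net_exists T_rep T_bounded.
  by have [P AP] := cvA J A nA; apply: cd; exists P; exact: ergodic_net_lim AP.
split.
  move=> [_ [P wP]]; have rgP := witness_rg_ker T_rep T_bounded wP.
  split; first by rewrite rgP; exact: (@op_ker_closed _ _ P).
  have [n [s [n0 Ps]]] := witness_ker_finite_rg T_rep T_bounded wP.
  exists n, s; split=> //; apply/seteqP; split=> [y|]; last exact: rg_sub_finite.
  by rewrite {1}rgP; exact: Ps.
by move=> [rg_closed [n [s [_ rg_fin]]]]; exact: closed_range_mean_ergodic rg_fin.
Qed.
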